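(* Let $(\mathcal{F},\mathcal{R})$ be an AFSM and fix a quasi-ordering $\succeq$ on sorts with well-founded strict part, inducing $\mathrm{Acc}$. For an RC-set $I$ for $\to_{\mathcal{R}}$, let $\to_{\mathrm{acc},I}$ be the relation with $f\,s_1\cdots s_m \to_{\mathrm{acc},I} s_i\,t_1\cdots t_n$ whenever both sides have base type, $i\in\mathrm{Acc}(f)$, and all $t_j$ are $I$-computable. Then there is an RC-set $C$ for $\to_{\mathcal{R}}$ such that $$C=\{\, s:\iota \mid \iota\in\mathcal{S},\ s \text{ is terminating under } \to_{\mathcal{R}}\cup\to_{\mathrm{acc},C},\ \text{and whenever } s\to_{\mathcal{R}}^* f\,s_1\cdots s_m:\iota \text{ then } s_i \text{ is } C\text{-computable for all } i\in\mathrm{Acc}(f)\,\}.$$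
   Context: Types: fix a set $\mathcal{S}$ of sorts; simple types are sorts and $\sigma\to\tau$ ($\to$ right-associative), so every type is $\sigma_1\to\dots\to\sigma_m\to\iota$ with $\iota\in\mathcal{S}$; a term has base type if its type is a sort. Fix pairwise disjoint sets $\mathcal{F}$ (function symbols), $\mathcal{V}$ (variables), each symbol typed and each containing infinitely many symbols of every type, and $\mathcal{M}$ (meta-variables), each $Z\in\mathcal{M}$ with a declaration $[\sigma_1\times\dots\times\sigma_k]\to\tau$; $k=\mathrm{ar}(Z)$. Meta-terms: $x$ ($x\in\mathcal V$), $f$ ($f\in\mathcal F$), typed application $s\,t$, abstraction $\lambda x.s$, and $Z\langle s_1,\dots,s_e\rangle:\tau$ when $Z:[\sigma_1\times\dots\times\sigma_k]\to\sigma_{k+1}\to\dots\to\sigma_e\to\tau$ and $s_i:\sigma_i$. Application is left-associative; everything is modulo $\alpha$-conversion. Terms are meta-terms without meta-variables. A pattern is $Z\langle x_1,\dots,x_k\rangle$ (distinct variables, $k=\mathrm{ar}(Z)$), $\lambda x.\ell$, or $a\,\ell_1\cdots\ell_n$ with $a\in\mathcal F\cup\mathcal V$ and $\ell,\ell_i$ patterns. A substitution $\gamma$ maps variables to terms and each meta-variable $Z$ with $\mathrm{ar}(Z)=k$ to a term $\lambda y_1\dots y_k.u$; for $k\le e$ (at most the total number of arguments of $Z$'s type) write $\gamma(Z)\approx_e\lambda x_1\dots x_e.s$ if $\gamma(Z)=\lambda x_1\dots x_e.s$, or $\gamma(Z)=\lambda x_1\dots x_i.t$ with $k\le i<e$,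 $t$ not an abstraction and $s=t\,x_{i+1}\cdots x_e$; then $x\gamma=\gamma(x)$, $f\gamma=f$, $(s\,t)\gamma=(s\gamma)(t\gamma)$, $(\lambda x.s)\gamma=\lambda x.(s\gamma)$ (capture-avoiding), $Z\langle s_1,\dots,s_e\rangle\gamma=t[x_1:=s_1\gamma,\dots,x_e:=s_e\gamma]$ where $\gamma(Z)\approx_e\lambda x_1\dots x_e.t$. A rule $\ell\Rightarrow r$ is a pair of closed meta-terms of equal type with $\ell$ a pattern $f\,\ell_1\cdots\ell_n$, $f\in\mathcal F$, and every meta-variable of $r$ occurring in $\ell$. A set $\mathcal R$ of rules defines $\to_{\mathcal R}$: the smallest relation on terms closed under all contexts (also below $\lambda$) containing $\ell\delta\to r\delta$ for rules and substitutions $\delta$ on the meta-variables of $\ell$, and $(\lambda x.s)t\to s[x:=t]$. Terminating means admitting no infinite reduction. An AFSM $(\mathcal F,\mathcal R)$ is a signature with such a rule set (and an arity function respected by the rules). Accessibility: given a quasi-ordering $\succeq$ on $\mathcal S$ with well-founded strict part $\succ$, for $\sigma=\sigma_1\to\dots\to\sigma_m\to\kappa$ ($\kappa\in\mathcal S$) and a sort $\iota$ define simultaneously: $\iota\succeq_+\sigma$ iff $\iota\succeq\kappa$ and $\iota\succ_-\sigma_i$ for all $i$; $\iota\succ_-\sigma$ iff $\iota\succ\kappa$ and $\iota\succeq_+\sigma_i$ for all $i$. For $f:\sigma_1\to\dots\to\sigma_m\to\iota\in\mathcal F$, $\mathrm{Acc}(f)=\{i\mid 1\le i\le m,\ \iota\succeq_+\sigma_i\}$.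 RC-sets: an RC-set for $\to_{\mathcal R}$ is a set $I$ of base-type terms such that every element of $I$ is terminating under $\to_{\mathcal R}$; $I$ is closed under $\to_{\mathcal R}$; and if $s=x\,s_1\cdots s_n$ with $x\in\mathcal V$, or $s=(\lambda x.u)\,s_0\cdots s_n$ ($n\ge0$), and every $t$ with $s\to_{\mathcal R}t$ lies in $I$, then $s\in I$. $I$-computability: $s:\iota$ with $\iota\in\mathcal S$ is $I$-computable iff $s\in I$; $s:\sigma\to\tau$ is $I$-computable iff $s\,t$ is $I$-computable for every $I$-computable $t:\sigma$. *)

(* Defs.v *)
(* Standard library only (no MathComp). *)
From Stdlib Require Export List Relations.
Export ListNotations.

Set Implicit Arguments.
Unset Strict Implicit.
Unset Printing Implicit Defensive.
Set Contextual Implicit.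

(** * Simple types *)

Inductive ty (S : Type) : Type :=
| Sort (iota : S)
| Arr (sigma tau : ty S).

Declare Scope ty_scope.
Delimit Scope ty_scope with ty.
Bind Scope ty_scope with ty.
Infix "~>" := Arr (at level 55, right associativity) : ty_scope.
Local Open Scope ty_scope.

(** [arrs [s1; ..; sm] t] is [s1 ~> .. ~> sm ~> t]. *)
Fixpoint arrs {S} (sigmas : list (ty S)) (tau : ty S) : ty S :=
  match sigmas with [] => tau | sigma :: sigmas' => sigma ~> arrs sigmas' tau end.

(** [idx sigmas sigma] is the type of positions of [sigmas] that hold [sigma]:
    an index [1 <= i <= m] together with its type [sigma_i]. *)
Inductive idx {S} : list (ty S) -> ty S -> Type :=
| here sigma sigmas : idx (sigma :: sigmas) sigma
| there rho sigmas sigma : idx sigmas sigma -> idx (rho :: sigmas) sigma.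

(** Sets of typed symbols are families indexed by types; symbols from different
    families, or of different types, are distinct by construction. *)
Definition infinite_each {S} (F : ty S -> Type) : Prop :=
  forall (sigma : ty S) (l : list (F sigma)), exists f : F sigma, ~ In f l.

(** * Meta-terms *)

(** Variables are a parameter [W] of the syntax, and the body of an abstraction
    lives over [ext W sigma], which is [W] with one new variable [new] of type
    [sigma].  Hence equality of meta-terms is equality modulo alpha, and a
    closed meta-term is one over the empty family of variables. *)
Inductive ext {S} (W : ty S -> Type) (sigma : ty S) : ty S -> Type :=
| new : ext W sigma sigma
| old tau (x : W tau) : ext W sigma tau.

Definition no_var {S} : ty S -> Type := fun _ => Empty_set.
Definition no_meta {S} : list (ty S) -> ty S -> Type := fun _ _ => Empty_set.

(** [M sigmas tau] is the set of meta-variables declared as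
    [[s1 x .. x sk] -> tau].  In [Meta Z a b] the first [k] arguments are [a],
    the remaining [e - k] are [b]. *)
Inductive mterm {S} (F : ty S -> Type) (M : list (ty S) -> ty S -> Type)
    (W : ty S -> Type) : ty S -> Type :=
| Var sigma (x : W sigma) : mterm F M W sigma
| Fun sigma (f : F sigma) : mterm F M W sigma
| App sigma tau (s : mterm F M W (sigma ~> tau)) (t : mterm F M W sigma) :
    mterm F M W tau
| Lam sigma tau (s : mterm F M (ext W sigma) tau) : mterm F M W (sigma ~> tau)
| Meta sigmas rhos tau (Z : M sigmas (arrs rhos tau))
    (a : forall sigma, idx sigmas sigma -> mterm F M W sigma)
    (b : forall rho, idx rhos rho -> mterm F M W rho) : mterm F M W tau.

Definition term {S} (F W : ty S -> Type) : ty S -> Type := mterm F no_meta W.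

Definition args {S} (F : ty S -> Type) (M : list (ty S) -> ty S -> Type)
    (W : ty S -> Type) (sigmas : list (ty S)) : Type :=
  forall sigma, idx sigmas sigma -> mterm F M W sigma.

Definition args_tail {S} {F : ty S -> Type} {M W rho sigmas}
    (s : args F M W (rho :: sigmas)) : args F M W sigmas :=
  fun _ i => s _ (there i).

(** [apps t s] is [t s1 .. sm]. *)
Fixpoint apps {S} {F : ty S -> Type} {M W sigmas tau} :
    mterm F M W (arrs sigmas tau) -> args F M W sigmas -> mterm F M W tau :=
  match sigmas return
    mterm F M W (arrs sigmas tau) -> args F M W sigmas -> mterm F M W tau with
  | [] => fun t _ => t
  | sigma :: sigmas' => fun t s => apps (App t (s _ here)) (args_tail s)
  end.

(** * Substitution of variables *)

Definition ren_up {S} {W U : ty S -> Type} {sigma}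
    (r : forall tau, W tau -> U tau) : forall tau, ext W sigma tau -> ext U sigma tau :=
  fun _ x => match x with new => new | old y => old (r _ y) end.

Fixpoint ren {S} {F : ty S -> Type} {M W U tau} (r : forall sigma, W sigma -> U sigma)
    (t : mterm F M W tau) {struct t} : mterm F M U tau :=
  match t with
  | Var x => Var (r _ x)
  | Fun f => Fun f
  | App s u => App (ren r s) (ren r u)
  | Lam s => Lam (ren (ren_up r) s)
  | Meta Z a b => Meta Z (fun _ i => ren r (a _ i)) (fun _ i => ren r (b _ i))
  end.

Definition sub {S} (F : ty S -> Type) (M : list (ty S) -> ty S -> Type)
    (W U : ty S -> Type) : Type :=
  forall sigma, W sigma -> mterm F M U sigma.

Definition sub_up {S} {F : ty S -> Type} {M W U sigma} (theta : sub F M W U) :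
    sub F M (ext W sigma) (ext U sigma) :=
  fun _ x => match x with
             | new => Var new
             | old y => ren (fun _ z => old z) (theta _ y)
             end.

Definition sub_cons {S} {F : ty S -> Type} {M W U sigma}
    (t : mterm F M U sigma) (theta : sub F M W U) : sub F M (ext W sigma) U :=
  fun _ x => match x in ext _ _ tau return mterm F M U tau with
             | new => t
             | old y => theta _ y
             end.

Fixpoint subst {S} {F : ty S -> Type} {M W U tau} (theta : sub F M W U)
    (t : mterm F M W tau) {struct t} : mterm F M U tau :=
  match t with
  | Var x => theta _ x
  | Fun f => Fun f
  | App s u => App (subst theta s) (subst theta u)
  | Lam s => Lam (subst (sub_up theta) s)
  | Meta Z a b =>
      Meta Z (fun _ i => subst theta (a _ i)) (fun _ i => subst theta (b _ i))
  end.

(** [subst1 s t] is [s[x := t]], where [x] is the variable [new] of [s]. *)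
Definition subst1 {S} {F : ty S -> Type} {M W sigma tau}
    (s : mterm F M (ext W sigma) tau) (t : mterm F M W sigma) : mterm F M W tau :=
  subst (sub_cons t (fun _ x => Var x)) s.

(** * Substitution of meta-variables *)

Definition exts {S} (W : ty S -> Type) (sigmas : list (ty S)) : ty S -> Type :=
  fun sigma => (W sigma + idx sigmas sigma)%type.

(** A meta-variable [Z] of arity [k] is mapped to a term [\y1 .. yk. u]; it is
    represented by [u], in which [yi] is the variable [inr i]. *)
Definition msub {S} (F : ty S -> Type) (M : list (ty S) -> ty S -> Type)
    (U : ty S -> Type) : Type :=
  forall sigmas tau, M sigmas tau -> term F (exts U sigmas) tau.

Definition msub_up {S} {F : ty S -> Type} {M U sigma} (gamma : msub F M U) :
    msub F M (ext U sigma) :=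
  fun _ _ Z => ren (fun _ x => match x with
                               | inl y => inl (old y)
                               | inr i => inr i
                               end) (gamma _ _ Z).

Definition lam_body_type {S} (F W : ty S -> Type) (upsilon : ty S) : Type :=
  match upsilon with
  | Sort _ => unit
  | sigma ~> tau => option (term F (ext W sigma) tau)
  end.

Definition no_lam_body {S} (F W : ty S -> Type) (upsilon : ty S) :
    lam_body_type F W upsilon :=
  match upsilon with Sort _ => tt | _ ~> _ => None end.

(** [Some u] on an abstraction with body [u], and [None] otherwise. *)
Definition lam_body {S} {F W : ty S -> Type} {sigma tau} (t : term F W (sigma ~> tau)) :
    option (term F (ext W sigma) tau) :=
  match t in mterm _ _ _ upsilon return lam_body_type F W upsilon with
  | Lam s => Some s
  | Var _ | Fun _ | App _ _ | Meta _ _ _ => no_lam_body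
  end.

(** [fill t theta b] strips as many leading abstractions of [t] as there are
    arguments in [b], adds the corresponding arguments to [theta], and finally
    applies [theta] once, as a simultaneous substitution; arguments left over
    when a non-abstraction is reached are applied to the result. *)
Fixpoint fill {S} {F : ty S -> Type} {rhos : list (ty S)} {W U tau} :
    term F W (arrs rhos tau) -> sub F no_meta W U -> args F no_meta U rhos ->
    term F U tau :=
  match rhos return
    term F W (arrs rhos tau) -> sub F no_meta W U -> args F no_meta U rhos ->
    term F U tau with
  | [] => fun t theta _ => subst theta t
  | rho :: rhos' => fun t theta b =>
      match lam_body t with
      | Some u => fill (rhos := rhos') u (sub_cons (b _ here) theta) (args_tail b)
      | None => apps (sigmas := rho :: rhos') (subst theta t) b
      end
  end.

(** Application of a substitution, given by [gamma] on meta-variables and by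
    [theta] on variables. *)
Fixpoint minst {S} {F : ty S -> Type} {M W tau} (t : mterm F M W tau) :
    forall U, msub F M U -> sub F no_meta W U -> term F U tau :=
  match t with
  | Var x => fun _ _ theta => theta _ x
  | Fun f => fun _ _ _ => Fun f
  | App s u => fun _ gamma theta => App (minst s gamma theta) (minst u gamma theta)
  | Lam s => fun _ gamma theta => Lam (minst s (msub_up gamma) (sub_up theta))
  | Meta Z a b => fun _ gamma theta =>
      fill (gamma _ _ Z)
        (fun _ x => match x with
                    | inl y => Var y
                    | inr i => minst (a _ i) gamma theta
                    end)
        (fun _ i => minst (b _ i) gamma theta)
  end.

(** * Patterns, rules and AFSMs *)

(** The arguments [b] in [pat_meta] are indexed by the empty list, so that the
    meta-variable has exactly [ar(Z)] arguments.  Variables of different types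
    are always distinct, so distinctness is required at equal types only. *)
Inductive pattern {S} {F : ty S -> Type} {M} : forall {W tau}, mterm F M W tau -> Prop :=
| pat_meta W sigmas tau (Z : M sigmas (arrs [] tau))
    (x : forall sigma, idx sigmas sigma -> W sigma) (b : args F M W []) :
    (forall sigma (i j : idx sigmas sigma), x sigma i = x sigma j -> i = j) ->
    pattern (Meta Z (fun _ i => Var (x _ i)) b)
| pat_lam W sigma tau (l : mterm F M (ext W sigma) tau) :
    pattern l -> pattern (Lam l)
| pat_fun W sigmas tau (f : F (arrs sigmas tau)) (l : args F M W sigmas) :
    (forall sigma (i : idx sigmas sigma), pattern (l _ i)) ->
    pattern (apps (Fun f) l)
| pat_var W sigmas tau (x : W (arrs sigmas tau)) (l : args F M W sigmas) :
    (forall sigma (i : idx sigmas sigma), pattern (l _ i)) ->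
    pattern (apps (Var x) l).

Inductive mv_in {S} {F : ty S -> Type} {M} : forall {sigmas upsilon},
    M sigmas upsilon -> forall {W tau}, mterm F M W tau -> Prop :=
| mv_here sigmas rhos tau (Z : M sigmas (arrs rhos tau)) W
    (a : args F M W sigmas) (b : args F M W rhos) : mv_in Z (Meta Z a b)
| mv_arg1 sigmas upsilon (Z : M sigmas upsilon) sigmas' rhos tau
    (Z' : M sigmas' (arrs rhos tau)) W (a : args F M W sigmas') (b : args F M W rhos)
    sigma (i : idx sigmas' sigma) : mv_in Z (a _ i) -> mv_in Z (Meta Z' a b)
| mv_arg2 sigmas upsilon (Z : M sigmas upsilon) sigmas' rhos tau
    (Z' : M sigmas' (arrs rhos tau)) W (a : args F M W sigmas') (b : args F M W rhos)
    rho (i : idx rhos rho) : mv_in Z (b _ i) -> mv_in Z (Meta Z' a b)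
| mv_appl sigmas upsilon (Z : M sigmas upsilon) W sigma tau
    (s : mterm F M W (sigma ~> tau)) t : mv_in Z s -> mv_in Z (App s t)
| mv_appr sigmas upsilon (Z : M sigmas upsilon) W sigma tau
    (s : mterm F M W (sigma ~> tau)) t : mv_in Z t -> mv_in Z (App s t)
| mv_lam sigmas upsilon (Z : M sigmas upsilon) W sigma tau
    (s : mterm F M (ext W sigma) tau) : mv_in Z s -> mv_in Z (Lam s).

Definition is_rule {S} {F : ty S -> Type} {M tau} (l r : mterm F M no_var tau) : Prop :=
  pattern l /\
  (exists sigmas (f : F (arrs sigmas tau)) (ls : args F M no_var sigmas),
      l = apps (Fun f) ls) /\
  (forall sigmas upsilon (Z : M sigmas upsilon), mv_in Z r -> mv_in Z l).

Fixpoint num_args {S} (sigma : ty S) : nat :=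
  match sigma with Sort _ => 0 | _ ~> tau => 1 + num_args tau end.

(** Every function symbol [f] that occurs in [t] has at least [ar f] arguments,
    given that [t] itself stands in head position of [n] further arguments. *)
Fixpoint respects {S} {F : ty S -> Type} {M W tau} (ar : forall sigma, F sigma -> nat)
    (n : nat) (t : mterm F M W tau) : Prop :=
  match t with
  | Var _ => True
  | Fun f => ar _ f <= n
  | App s u => respects ar (1 + n) s /\ respects ar 0 u
  | Lam s => respects ar 0 s
  | Meta _ a b =>
      (forall sigma i, respects ar 0 (a sigma i)) /\
      (forall rho i, respects ar 0 (b rho i))
  end.

Record afsm {S} (F : ty S -> Type) (M : list (ty S) -> ty S -> Type) : Type := {
  rule : forall tau, mterm F M no_var tau -> mterm F M no_var tau -> Prop;
  rule_ok : forall tau (l r : mterm F M no_var tau), rule l r -> is_rule l r;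
  ar : forall sigma, F sigma -> nat;
  ar_le : forall sigma (f : F sigma), ar f <= num_args sigma;
  ar_ok : forall tau (l r : mterm F M no_var tau), rule l r ->
    respects ar 0 l /\ respects ar 0 r
}.

(** * Reduction *)

(** Rules are closed, so only the meta-variable part of the substitution matters;
    [delta] is total, but its values outside the meta-variables of [l] are
    irrelevant. *)
Inductive red {S} {F : ty S -> Type} {M} (A : afsm F M) :
    forall {W tau}, term F W tau -> term F W tau -> Prop :=
| red_rule W tau (l r : mterm F M no_var tau) (delta : msub F M W) :
    rule A l r ->
    red A (minst l delta (fun _ x => match x with end))
          (minst r delta (fun _ x => match x with end))
| red_beta W sigma tau (s : term F (ext W sigma) tau) (t : term F W sigma) :
    red A (App (Lam s) t) (subst1 s t)
| red_appl W sigma tau (s s' : term F W (sigma ~> tau)) (t : term F W sigma) :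
    red A s s' -> red A (App s t) (App s' t)
| red_appr W sigma tau (s : term F W (sigma ~> tau)) (t t' : term F W sigma) :
    red A t t' -> red A (App s t) (App s t')
| red_lam W sigma tau (s s' : term F (ext W sigma) tau) :
    red A s s' -> red A (Lam s) (Lam s').

(** Terms of all types together, so that relations between terms of different
    types can be iterated. *)
Definition any_term {S} (F V : ty S -> Type) : Type := {sigma : ty S & term F V sigma}.

Definition pack {S} {F V : ty S -> Type} {sigma} (s : term F V sigma) : any_term F V :=
  existT _ sigma s.

Inductive red_step {S} {F : ty S -> Type} {M} (A : afsm F M) {V} : relation (any_term F V) :=
| red_step_intro sigma (s t : term F V sigma) :
    red A s t -> red_step A (pack s) (pack t).

Definition terminating {T} (R : relation T) (s : T) : Prop :=
  ~ exists u : nat -> T, u 0 = s /\ forall n, R (u n) (u (1 + n)).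

(** * Accessibility *)

Definition strict {S} (succeq : relation S) : relation S :=
  fun a b => succeq a b /\ ~ succeq b a.

Definition wf_quasi_order {S} (succeq : relation S) : Prop :=
  preorder S succeq /\ well_founded (fun a b => strict succeq b a).

Inductive succeq_plus {S} (succeq : relation S) (iota : S) : ty S -> Prop :=
| succeq_plus_intro sigmas kappa :
    succeq iota kappa ->
    (forall sigma, idx sigmas sigma -> succ_minus succeq iota sigma) ->
    succeq_plus succeq iota (arrs sigmas (Sort kappa))
with succ_minus {S} (succeq : relation S) (iota : S) : ty S -> Prop :=
| succ_minus_intro sigmas kappa :
    strict succeq iota kappa ->
    (forall sigma, idx sigmas sigma -> succeq_plus succeq iota sigma) ->
    succ_minus succeq iota (arrs sigmas (Sort kappa)).

(** The position [i] belongs to [Acc(f)]. *)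
Definition accessible {S} (succeq : relation S) {F : ty S -> Type} {sigmas iota}
    (f : F (arrs sigmas (Sort iota))) {sigma} (i : idx sigmas sigma) : Prop :=
  succeq_plus succeq iota sigma.

(** * RC-sets and computability *)

Definition base_set {S} (F V : ty S -> Type) : Type :=
  forall iota : S, term F V (Sort iota) -> Prop.

Record RC_set {S} {F : ty S -> Type} {M} (A : afsm F M) {V} (I : base_set F V) : Prop := {
  RC_terminating : forall iota (s : term F V (Sort iota)),
    I _ s -> terminating (red_step A) (pack s);
  RC_closed : forall iota (s t : term F V (Sort iota)), I _ s -> red A s t -> I _ t;
  RC_var : forall sigmas iota (x : V (arrs sigmas (Sort iota)))
      (ss : args F no_meta V sigmas),
    (forall t, red A (apps (Var x) ss) t -> I _ t) -> I _ (apps (Var x) ss);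
  RC_beta : forall sigma sigmas iota (u : term F (ext V sigma) (arrs sigmas (Sort iota)))
      (s0 : term F V sigma) (ss : args F no_meta V sigmas),
    (forall t, red A (apps (App (Lam u) s0) ss) t -> I _ t) ->
    I _ (apps (App (Lam u) s0) ss)
}.

Fixpoint computable {S} {F V : ty S -> Type} (I : base_set F V) (sigma : ty S) :
    term F V sigma -> Prop :=
  match sigma with
  | Sort iota => fun s => I iota s
  | rho ~> tau => fun s => forall t : term F V rho, computable I t -> computable I (App s t)
  end.

Inductive acc_step {S} (succeq : relation S) {F V : ty S -> Type} (I : base_set F V) :
    relation (any_term F V) :=
| acc_step_intro sigmas iota (f : F (arrs sigmas (Sort iota)))
    (ss : args F no_meta V sigmas) rhos kappa (i : idx sigmas (arrs rhos (Sort kappa)))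
    (ts : args F no_meta V rhos) :
    accessible succeq f i ->
    (forall rho (j : idx rhos rho), computable I (ts _ j)) ->
    acc_step succeq I (pack (apps (Fun f) ss)) (pack (apps (ss _ i) ts)).

(* Main.v *)
(** The right-hand side of the equation for [C] is an operator [acc_op] on
    [base_set F V], and every fixpoint of it is an RC-set: a term whose head is a
    variable or an abstraction has no accessibility steps, so it inherits both
    conditions from its reducts.

    A fixpoint exists because, at a sort [iota], [acc_op] looks at its argument
    only at sorts [kappa] with [iota] above or equivalent to [kappa], and it is
    monotone in the values at the sorts equivalent to [iota] as long as those
    strictly below [iota] stay fixed: computability at [sigma] is monotone in these
    values when [succeq_plus iota sigma] and antitone when [succ_minus iota sigma],
    and the latter governs the arguments [t_j] of an accessibility step. So [C] is
    defined by well-founded recursion on sorts, taking a greatest fixpoint in each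
    equivalence class. *)

Require Import Defs.
From Stdlib Require Import Classical FunctionalExtensionality.

(** * Polarity of sorts in types *)

Section Accessibility.
Variables (S : Type) (succeq : relation S).

(** Peeling off one argument at a time turns the definition over argument lists into a recursion on
    arrows, as induction on types requires. *)
Lemma succeq_plus_arr iota (rho tau : ty S) :
  succeq_plus succeq iota (rho ~> tau) ->
  succ_minus succeq iota rho /\ succeq_plus succeq iota tau.
Proof.
  intros H. inversion H as [sigmas kappa Hk Hs E].
  destruct sigmas as [|sigma sigmas]; simpl in E; [discriminate|].
  injection E as <- <-. split.
  - apply Hs. constructor.
  - constructor; [exact Hk|]. intros tau i. apply Hs. now constructor.
Qed.

Lemma succ_minus_arr iota (rho tau : ty S) :
  succ_minus succeq iota (rho ~> tau) ->
  succeq_plus succeq iota rho /\ succ_minus succeq iota tau.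
Proof.
  intros H. inversion H as [sigmas kappa Hk Hs E].
  destruct sigmas as [|sigma sigmas]; simpl in E; [discriminate|].
  injection E as <- <-. split.
  - apply Hs. constructor.
  - constructor; [exact Hk|]. intros tau i. apply Hs. now constructor.
Qed.

Lemma succeq_plus_sort iota kappa :
  succeq_plus succeq iota (Sort kappa) -> succeq iota kappa.
Proof.
  intros H. inversion H as [sigmas kappa' Hk Hs E].
  destruct sigmas; simpl in E; [|discriminate]. now injection E as <-.
Qed.

Lemma succ_minus_sort iota kappa :
  succ_minus succeq iota (Sort kappa) -> strict succeq iota kappa.
Proof.
  intros H. inversion H as [sigmas kappa' Hk Hs E].
  destruct sigmas; simpl in E; [|discriminate]. now injection E as <-.
Qed.

Lemma succeq_plus_arrs iota (rhos : list (ty S)) kappa :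
  succeq_plus succeq iota (arrs rhos (Sort kappa)) ->
  succeq iota kappa /\ forall rho, idx rhos rho -> succ_minus succeq iota rho.
Proof.
  induction rhos as [|rho rhos IH]; simpl; intros H.
  - split; [now apply succeq_plus_sort|]. intros rho i. inversion i.
  - apply succeq_plus_arr in H as [Hrho H]. apply IH in H as [Hk H].
    split; [exact Hk|]. intros tau i. inversion i; subst; auto.
Qed.

End Accessibility.

(** * Heads of terms and termination *)

Fixpoint fun_headed {S} {F : ty S -> Type} {M W tau} (t : mterm F M W tau) : Prop :=
  match t with
  | Fun _ => True
  | App s _ => fun_headed s
  | Var _ | Lam _ | Meta _ _ _ => False
  end.

Lemma fun_headed_apps S (F : ty S -> Type) M W sigmas tau
    (t : mterm F M W (arrs sigmas tau)) (ss : args F M W sigmas) :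
  fun_headed (apps t ss) = fun_headed t.
Proof.
  induction sigmas as [|sigma sigmas IH]; simpl in *; [reflexivity|].
  now rewrite IH.
Qed.

Lemma terminating_step {T} (R : relation T) (s t : T) :
  terminating R s -> R s t -> terminating R t.
Proof.
  intros Hs Hst (u & <- & Hu). apply Hs.
  exists (fun n => match n with 0 => s | Datatypes.S m => u m end).
  split; [reflexivity|]. intros [|n]; [exact Hst|apply Hu].
Qed.

Lemma terminating_intro {T} (R : relation T) (s : T) :
  (forall t, R s t -> terminating R t) -> terminating R s.
Proof.
  intros H (u & <- & Hu). apply (H (u 1) (Hu 0)).
  exists (fun n => u (1 + n)). split; [reflexivity|]. intros n. apply Hu.
Qed.

(** [P] is an invariant: an infinite [R']-reduction from [s] stays inside [P], so each of its steps
    is an [R]-step. *)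
Lemma terminating_incl {T} (R R' : relation T) (P : T -> Prop) (s : T) :
  (forall t t', P t -> R' t t' -> R t t' /\ P t') -> P s ->
  terminating R s -> terminating R' s.
Proof.
  intros HR Hs H (u & <- & Hu). apply H. exists u. split; [reflexivity|].
  assert (HP : forall n, P (u n)).
  { induction n as [|n IH]; [exact Hs|]. apply (HR _ _ IH (Hu n)). }
  intros n. apply (HR _ _ (HP n) (Hu n)).
Qed.

(** * The operator and its monotonicity *)

Section GreatestFixpoint.
Variables (S : Type) (F V : ty S -> Type) (M : list (ty S) -> ty S -> Type).
Variables (A : afsm F M) (succeq : relation S).
Hypothesis succeq_trans : transitive _ succeq.
Hypothesis succeq_refl : reflexive _ succeq.
Hypothesis strict_wf : well_founded (fun a b => strict succeq b a).

Definition acc_op (I : base_set F V) : base_set F V := fun iota s =>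
  terminating (union _ (red_step A) (acc_step succeq I)) (pack s) /\
  forall (sigmas : list (ty S)) (f : F (arrs sigmas (Sort iota)))
      (ss : args F no_meta V sigmas),
    clos_refl_trans _ (red A) s (apps (Fun f) ss) ->
    forall (sigma : ty S) (i : idx sigmas sigma),
      accessible succeq f i -> computable I (ss sigma i).

Lemma strict_succeq a b c : strict succeq a b -> succeq b c -> strict succeq a c.
Proof.
  intros [Hab Hba] Hbc. split; [now apply (succeq_trans _ b)|].
  intros Hca. apply Hba. now apply (succeq_trans _ c).
Qed.

Lemma succeq_strict a b c : succeq a b -> strict succeq b c -> strict succeq a c.
Proof.
  intros Hab [Hbc Hcb]. split; [now apply (succeq_trans _ b)|].
  intros Hca. apply Hcb. now apply (succeq_trans _ a).
Qed.

(** Since [strict] implies [succeq], the two clauses force equality strictly below [iota] and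
    inclusion on the class of [iota]. *)
Definition le_upto (iota : S) (I J : base_set F V) : Prop :=
  (forall kappa s, succeq iota kappa -> I kappa s -> J kappa s) /\
  (forall kappa s, strict succeq iota kappa -> J kappa s -> I kappa s).

Lemma le_upto_below iota kappa I J :
  succeq iota kappa -> le_upto iota I J -> le_upto kappa I J.
Proof.
  intros Hk [H1 H2]. split; intros kappa' s Hk'.
  - apply H1. now apply (succeq_trans _ kappa).
  - apply H2. now apply (succeq_strict _ kappa).
Qed.

(** Both claims go through one induction on [sigma], because the argument side of an arrow swaps the
    polarity. *)
Lemma computable_mono iota I J sigma : le_upto iota I J ->
  (succeq_plus succeq iota sigma ->
     forall s : term F V sigma, computable I s -> computable J s) /\
  (succ_minus succeq iota sigma ->
     forall s : term F V sigma, computable J s -> computable I s).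
Proof.
  intros [HIJ HJI]. induction sigma as [kappa|rho [IHr1 IHr2] tau [IHt1 IHt2]].
  - split; simpl; intros H s.
    + now apply HIJ, succeq_plus_sort.
    + now apply HJI, succ_minus_sort.
  - split; simpl; intros H s Hs t Ht.
    + apply succeq_plus_arr in H as [Hr Ht']. auto.
    + apply succ_minus_arr in H as [Hr Ht']. auto.
Qed.

Definition sort_below (iota : S) (p : any_term F V) : Prop :=
  exists kappa, projT1 p = Sort kappa /\ succeq iota kappa.

(** The arguments [ts] sit at negative types, so their computability passes from [J] back to [I].
    The step never leaves the sorts below [iota], so whole reductions can be transferred. *)
Lemma acc_step_antitone iota I J p q : le_upto iota I J -> sort_below iota p ->
  acc_step succeq J p q -> acc_step succeq I p q /\ sort_below iota q.
Proof.
  intros HIJ (kappa' & E & Hk') H.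
  destruct H as [sigmas kappa f ss rhos kappa'' i ts Hf Hts].
  simpl in E. injection E as E. subst kappa'.
  pose proof (succeq_plus_arrs _ _ _ _ _ Hf) as [Hk Hr]. split.
  - constructor; [exact Hf|]. intros rho j.
    pose proof (le_upto_below _ _ _ _ Hk' HIJ) as HIJ'.
    apply (proj2 (computable_mono _ _ _ _ HIJ') (Hr _ j)), Hts.
  - exists kappa''. split; [reflexivity|]. now apply (succeq_trans _ kappa).
Qed.

Lemma acc_op_mono iota I J s :
  le_upto iota I J -> acc_op I iota s -> acc_op J iota s.
Proof.
  intros HIJ [Hterm Hacc]. split.
  - revert Hterm. apply terminating_incl with (P := sort_below iota).
    + intros p q Hp [H|H].
      * split; [now left|]. now destruct H.
      * apply (acc_step_antitone _ _ _ _ _ HIJ Hp) in H as [H Hq].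
        split; [now right|exact Hq].
    + now exists iota.
  - intros sigmas f ss Hred sigma i Hi.
    apply (proj1 (computable_mono _ _ _ _ HIJ) Hi). eapply Hacc; eauto.
Qed.

(** * Greatest fixpoints by recursion on sorts *)

(** Knaster-Tarski on the class of [iota]: the union of all post-fixpoints [J] that extend the
    values [low] already built strictly below. *)
Definition acc_fix_at (iota : S)
    (low : forall kappa, strict succeq iota kappa -> term F V (Sort kappa) -> Prop) :
    term F V (Sort iota) -> Prop := fun s =>
  exists J : base_set F V,
    (forall kappa (h : strict succeq iota kappa) t, J kappa t <-> low kappa h t) /\
    (forall kappa, succeq iota kappa -> succeq kappa iota ->
       forall t, J kappa t -> acc_op J kappa t) /\
    J iota s.

Definition acc_fix : base_set F V :=
  Fix strict_wf (fun iota => term F V (Sort iota) -> Prop) acc_fix_at.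

Lemma acc_fix_eq iota : acc_fix iota = acc_fix_at iota (fun kappa _ => acc_fix kappa).
Proof.
  unfold acc_fix at 1. rewrite Fix_eq; [reflexivity|].
  intros kappa f g E. f_equal.
  extensionality kappa'. extensionality h. apply E.
Qed.

Lemma acc_fix_post iota s : acc_fix iota s -> acc_op acc_fix iota s.
Proof.
  rewrite acc_fix_eq. intros (J & Hlow & Hpost & Hs).
  apply acc_op_mono with (I := J); [|now apply Hpost].
  split; intros kappa t Hk Ht; [|now apply (Hlow kappa Hk)].
  (* For [kappa] equivalent to [iota], the same [J] witnesses membership at [kappa]; otherwise
     [kappa] is strictly below and the values agree. *)
  destruct (classic (succeq kappa iota)) as [Hk'|Hk'].
  - rewrite acc_fix_eq. exists J. split; [|split; [|exact Ht]].
    + intros kappa' h. exact (Hlow _ (succeq_strict _ _ _ Hk h)).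
    + intros kappa' H H'.
      apply Hpost; now apply (succeq_trans _ kappa).
  - now apply (Hlow kappa (conj Hk Hk')).
Qed.

Lemma acc_fix_pre iota : forall s, acc_op acc_fix iota s -> acc_fix iota s.
Proof.
  induction (strict_wf iota) as [iota _ IH]. intros s Hs.
  (* By monotonicity [acc_op acc_fix] is again a post-fixpoint; the induction hypothesis makes it
     agree with [acc_fix] strictly below. *)
  rewrite acc_fix_eq. exists (acc_op acc_fix).
  split; [|split; [|exact Hs]].
  - intros kappa h t. split; [now apply IH|apply acc_fix_post].
  - intros kappa Hk _ t. apply acc_op_mono.
    split; intros kappa' t' Hk'; [apply acc_fix_post|].
    apply IH. now apply (succeq_strict _ kappa).
Qed.

(** * Fixpoints are RC-sets *)

Lemma acc_op_closed I iota (s t : term F V (Sort iota)) :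
  acc_op I iota s -> red A s t -> acc_op I iota t.
Proof.
  intros [Hterm Hacc] Hst. split.
  - eapply terminating_step; [exact Hterm|]. left. now constructor.
  - intros sigmas f ss H. apply (Hacc sigmas f ss).
    eapply rt_trans; [apply rt_step; exact Hst|exact H].
Qed.

Lemma red_step_inv (p q : any_term F V) :
  red_step A p q -> exists t, red A (projT2 p) t /\ q = pack t.
Proof. intros [sigma s t H]. now exists t. Qed.

Lemma acc_op_neutral I iota (s : term F V (Sort iota)) :
  ~ fun_headed s -> (forall t, red A s t -> acc_op I iota t) -> acc_op I iota s.
Proof.
  intros Hs H. split.
  - apply terminating_intro. intros q [Hq|Hq].
    + apply red_step_inv in Hq as (t & Ht & ->). now apply H.
    + exfalso. apply Hs. change (fun_headed (projT2 (pack s))).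
      destruct Hq. simpl. now rewrite fun_headed_apps.
  (* The reduction to an [f]-headed term cannot be empty, so its first step leads to a reduct
     covered by [H]. *)
  - intros sigmas f ss Hred. apply clos_rt_rt1n in Hred.
    inversion Hred as [E|t t' Hst Ht E].
    + exfalso. apply Hs. rewrite E. now rewrite fun_headed_apps.
    + apply (H t Hst). now apply clos_rt1n_rt.
Qed.

Lemma acc_op_fixpoint_RC_set (C : base_set F V) :
  (forall iota s, C iota s <-> acc_op C iota s) -> RC_set A C.
Proof.
  intros HC. split.
  - intros iota s Hs. apply HC in Hs as [Hs _]. revert Hs.
    apply terminating_incl with (P := fun _ => True); [|exact I].
    intros p q _ H. split; [now left|exact I].
  - intros iota s t Hs Hst. apply HC. apply HC in Hs. eapply acc_op_closed; eauto.
  - intros sigmas iota x ss H. apply HC, acc_op_neutral.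
    + now rewrite fun_headed_apps.
    + intros t Ht. now apply HC, H.
  - intros sigma sigmas iota u s0 ss H. apply HC, acc_op_neutral.
    + rewrite fun_headed_apps. simpl. tauto.
    + intros t Ht. now apply HC, H.
Qed.

End GreatestFixpoint.

Theorem theorem2p12 (S : Type) (F V : ty S -> Type) (M : list (ty S) -> ty S -> Type)
    (F_infinite : infinite_each F) (V_infinite : infinite_each V)
    (A : afsm F M) (succeq : relation S) (succeq_wf : wf_quasi_order succeq) :
  exists C : base_set F V,
    RC_set A C /\
    forall (iota : S) (s : term F V (Sort iota)),
      C iota s <->
      terminating (union _ (red_step A) (acc_step succeq C)) (pack s) /\
      forall (sigmas : list (ty S)) (f : F (arrs sigmas (Sort iota)))
          (ss : args F no_meta V sigmas),
        clos_refl_trans _ (red A) s (apps (Fun f) ss) ->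
        forall (sigma : ty S) (i : idx sigmas sigma),
          accessible succeq f i -> computable C (ss sigma i).
Proof.
  destruct succeq_wf as [[Hrefl Htrans] Hwf].
  assert (HC : forall iota (s : term F V (Sort iota)),
    acc_fix S F V M A succeq Hwf iota s <->
    acc_op S F V M A succeq (acc_fix S F V M A succeq Hwf) iota s).
  { intros iota s. split; [now apply acc_fix_post|now apply acc_fix_pre]. }
  exists (acc_fix S F V M A succeq Hwf).
  split; [|exact HC]. eapply acc_op_fixpoint_RC_set. exact HC.
Qed.
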